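(* Let $n,m\ge 1$ and let $\mathfrak{g}$ be of type $B_n$ ($\mathfrak{so}_{2n+1}$). The multiplicity of the trivial representation $V(0)$ in $V(\omega_n)^{\otimes 2m}$ (equivalently, the number of connected components of the crystal $B(\omega_n)^{\otimes 2m}$ isomorphic to $B(0)$) equals the determinant of the $n\times n$ Hankel matrix \[ \left[\operatorname{Cat}_{2n-i-j+m}\right]_{i,j=1}^{n}. \]
   Context: $V(\omega_n)$ is the spin representation of $\mathfrak{so}_{2n+1}$ (of dimension $2^n$), the irreducible representation whose highest weight is the fundamental weight $\omega_n=\tfrac12(\epsilon_1+\cdots+\epsilon_n)$. $\operatorname{Cat}_k=\frac{1}{k+1}\binom{2k}{k}$ is the $k$-th Catalan number. *)

(* Defs.v *)
From HB Require Import structures.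
From mathcomp Require Import all_boot all_order all_algebra.
Set Implicit Arguments. Unset Strict Implicit. Unset Printing Implicit Defensive.
Import Order.TTheory GRing.Theory Num.Theory.

Definition Cat (k : nat) : nat := 'C(k.*2, k) %/ k.+1.

(* The spin crystal B(omega_n) of type B_n: sign vectors (true = +1/2,
   false = -1/2); the weight of b is (1/2) sum_k (+-1) e_k. *)
Definition spin (n : nat) := {ffun 'I_n -> bool}.

(* k-th sign (0-based), false outside the range *)
Definition sgn n (b : spin n) (k : nat) : bool :=
  if insub k is Some j then b j else false.

(* phi_i and eps_i on B(omega_n), with i : 'I_n standing for the Dynkin node
   i+1; simple roots alpha_i = e_i - e_{i+1} (i < n), alpha_n = e_n.
   f_i maps (.., +_i, -_{i+1}, ..) to (.., -_i, +_{i+1}, ..) for i < n,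
   and f_n maps +_n to -_n; the crystal is minuscule so phi, eps are 0/1. *)
Definition phi1 n (i : 'I_n) (b : spin n) : nat :=
  if i.+1 < n then sgn b i && ~~ sgn b i.+1 else sgn b i.
Definition eps1 n (i : 'I_n) (b : spin n) : nat :=
  if i.+1 < n then ~~ sgn b i && sgn b i.+1 else ~~ sgn b i.

(* Tensor product rule (signature rule): factor b_j contributes
   -^{eps_i b_j} +^{phi_i b_j}; adjacent (+,-) pairs cancel.  The state is
   (number of uncancelled -, number of uncancelled +). *)
Definition sig_step n (i : 'I_n) (st : nat * nat) (b : spin n) : nat * nat :=
  let c := minn st.2 (eps1 i b) in
  (st.1 + (eps1 i b - c), st.2 - c + phi1 i b).

Definition eps_tens n (i : 'I_n) (s : seq (spin n)) : nat :=
  (foldl (sig_step i) (0, 0) s).1.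
Definition phi_tens n (i : 'I_n) (s : seq (spin n)) : nat :=
  (foldl (sig_step i) (0, 0) s).2.

(* doubled k-th coordinate of the weight of b_1 (x) ... (x) b_r *)
Definition wt2 n (s : seq (spin n)) (k : 'I_n) : int :=
  \sum_(b <- s) (if b k then 1 else -1).

(* b lies in a connected component isomorphic to B(0), i.e. it is an
   isolated vertex of weight 0 with all eps_i = phi_i = 0. *)
Definition trivial_comp n (s : seq (spin n)) : bool :=
  [forall i : 'I_n, (eps_tens i s == 0) && (phi_tens i s == 0)] &&
  [forall k : 'I_n, wt2 s k == 0].

Definition mult_trivial (n r : nat) : nat :=
  #|[set t : r.-tuple (spin n) | trivial_comp (tval t)]|.

(* Main.v *)
(* A tensor of spin sign vectors generates a trivial component iff the partial
   sums of its doubled weights stay dominant and return to 0.  Shifted by 2 rho,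
   these are walks in the open Weyl chamber x_1 > ... > x_n > 0 with steps
   (+-1, ..., +-1), from 2 rho to 2 rho.  Let B(s, x) be the number of +-1 walks
   of length s from x to 1 that stay positive.  The determinant of the matrix
   [B(r + 2(n-j), x_i)] satisfies the recurrence of the walks of length r from x
   to 2 rho: expanding its rows by B(s+1, x) = B(s, x+1) + B(s, x-1) gives one
   term for each step, and the steps onto a wall give a zero row or two equal
   rows.  At x = 2 rho the matrix is the Catalan Hankel matrix up to a
   unitriangular factor, since B(a + b, 1) = sum_x B(a, x) B(b, x). *)
Require Import Defs.
From mathcomp Require Import all_boot all_order all_algebra.
From mathcomp Require Import perm zify.
Import GRing.Theory Num.Theory.
Local Open Scope ring_scope.

(* Positive +-1 walks of length s from x to 1: the heights of Dyck paths are
   shifted by one, so that x = 0 is the wall. *)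
Fixpoint ballot (s x : nat) : nat :=
  match s, x with
  | 0, _ => x == 1%N
  | s'.+1, 0 => 0
  | s'.+1, y.+1 => (ballot s' y.+2 + ballot s' y)%N
  end.

(** * Ballot numbers and Catalan numbers *)

Section Ballot.
Local Open Scope nat_scope.

Lemma ballotx0 s : ballot s 0 = 0.
Proof. by case: s. Qed.

Lemma ballotS s x : 0 < x -> ballot s.+1 x = ballot s x.+1 + ballot s x.-1.
Proof. by case: x. Qed.

Lemma ballot_gt s x : s.+1 < x -> ballot s x = 0.
Proof.
elim: s x => [|s IHs] [|x] //= lt_sx; first by case: x lt_sx.
by rewrite !IHs //; lia.
Qed.

Lemma ballot_diag s : ballot s s.+1 = 1.
Proof. by elim: s => //= s ->; rewrite ballot_gt. Qed.

Lemma ballot_parity s x : odd s = odd x -> ballot s x = 0.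
Proof.
elim: s x => [|s IHs] [|x] //= odd_sx; first by case: x odd_sx.
by rewrite !IHs //=; move: odd_sx; case: (odd s); case: (odd x).
Qed.

Arguments ballot : simpl never.

(** Summation by parts: the step relation on heights is symmetric, so one step can pass from one
    factor to the other, up to boundary terms at [N]. *)
Lemma ballot_Darboux a b N :
  \sum_(x < N.+1) ballot a.+1 x * ballot b x + ballot a N * ballot b N.+1 =
  \sum_(x < N.+1) ballot a x * ballot b.+1 x + ballot a N.+1 * ballot b N.
Proof.
elim: N => [|N IHN]; first by rewrite !big_ord1 !ballotx0 !muln0.
rewrite big_ord_recr [in RHS]big_ord_recr /= !ballotS //=.
by rewrite mulnDl mulnDr; move: IHN; do 2 move: (bigop _ _ _) => ?; lia.
Qed.

(** A walk from 1 to 1 is cut at height [x]. The bound on [N] makes the boundary terms of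
    [ballot_Darboux] vanish. *)
Lemma ballot_convolution a b N : b.+2 <= N ->
  \sum_(x < N) ballot a x * ballot b x = ballot (a + b) 1.
Proof.
elim: b a => [|b IHb] a le_bN.
  have lt1N : 1 < N by [].
  rewrite (bigD1 (Ordinal lt1N)) //= big1 ?addn0 ?muln1 // => i ne_i1.
  rewrite [ballot 0 i](_ : _ = 0) ?muln0 //; apply/eqP; rewrite eqb0.
  by apply/eqP => i1; case/eqP: ne_i1; apply: val_inj.
rewrite addnS -addSn -(IHb a.+1); last by lia.
case: N le_bN {IHb} => // N le_bN; have := ballot_Darboux a b N.
by rewrite !(@ballot_gt b) ?muln0 ?addn0 => [->||]; lia.
Qed.

Lemma sum_nat_double (F : nat -> nat) n :
  \sum_(x < n.*2) F x = \sum_(k < n) (F k.*2 + F k.*2.+1).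
Proof.
elim: n => [|n IHn]; first by rewrite !big_ord0.
by rewrite doubleS !big_ord_recr /= IHn addnA.
Qed.

(** Reflection principle, in additive form, with [q] up-steps. The factor [0 < q] removes the
    reflected term at [q = 0], where [q.-1] is 0 too. *)
Lemma ballot_binomial q h :
  ballot (q.*2 + h) h.+1 + (0 < q) * 'C(q.*2 + h, q.-1) = 'C(q.*2 + h, q).
Proof.
move def_s: (q.*2 + h) => s; elim: s q h def_s => [|s IHs] q h def_s.
  have [-> ->] : q = 0 /\ h = 0 by lia.
  by [].
case: q def_s => [|q] def_s.
  by rewrite -def_s double0 add0n ballot_diag bin0.
rewrite mul1n binS ballotS //=.
have E1 := IHs q h.+1 ltac:(lia).
case: h def_s E1 => [|h] def_s E1; last first.
  have E2 := IHs q.+1 h ltac:(lia).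
  rewrite mul1n /= in E2.
  case: q def_s E1 E2 => [|q] def_s E1 E2.
    by rewrite !bin0 in E1 E2 *; lia.
  by rewrite !mul1n /= in E1; rewrite [in 'C(s.+1, q.+1)]binS; lia.
(* For [h = 0] the step down reaches the wall; its binomial difference also vanishes, since
   [s = 2q + 1]. *)
rewrite ballotx0.
have sym : 'C(s, q.+1) = 'C(s, q).
  by rewrite -bin_sub; [congr 'C(_, _)|]; lia.
case: q def_s E1 sym => [|q] def_s E1 sym.
  by rewrite !bin0 in E1 sym *; lia.
by rewrite !mul1n /= in E1; rewrite [in 'C(s.+1, q.+1)]binS; lia.
Qed.

Lemma ballot_Cat k : ballot k.*2 1 = Cat k.
Proof.
have := ballot_binomial k 0; rewrite addn0 /Cat => def_b.
suff -> : 'C(k.*2, k) = ballot k.*2 1 * k.+1 by rewrite mulnK.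
case: k def_b => [|k] //; rewrite mul1n /= => def_b.
have := mul_bin_left (k.+1).*2 k.
have -> : (k.+1).*2 - k = k.+2 by lia.
rewrite -def_b mulnDr [k.+1 * ballot _ _]mulnC; lia.
Qed.

End Ballot.

(** * Trivial components as closed walks in the Weyl chamber *)

Section Walks.
Local Open Scope nat_scope.
Context {n : nat}.
Implicit Types (c : {ffun 'I_n -> nat}) (b : spin n) (s : seq (spin n)).

(* A state records the values phi_i of a highest weight prefix, that is, its
   weight in the basis of fundamental weights. *)
Definition allowed c b := [forall i, eps1 i b <= c i].
Definition next_state c b : {ffun 'I_n -> nat} :=
  [ffun i => c i - eps1 i b + phi1 i b].
Definition null_state : {ffun 'I_n -> nat} := [ffun => 0].

Fixpoint good c s : bool :=
  if s is b :: s' then allowed c b && good (next_state c b) s'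
  else c == null_state.

(* hgt c i + 1 is the i-th coordinate of 2(lambda + rho), lambda the weight of
   the state c. *)
Definition hgt c (i : nat) : nat :=
  \sum_(k < n | i <= k) (if k.+1 < n then (c k).+1.*2 else c k).

Lemma sgn_ord b (i : 'I_n) : sgn b i = b i.
Proof. by rewrite /sgn valK. Qed.

Lemma hgt_rec c (i : 'I_n) :
  hgt c i = (if i.+1 < n then (c i).+1.*2 else c i) + hgt c i.+1.
Proof.
rewrite /hgt (bigD1 i) //=; congr (_ + _); apply: eq_bigl => k.
by rewrite ltn_neqAle andbC eq_sym.
Qed.

Lemma hgt_out c i : n <= i -> hgt c i = 0.
Proof. by move=> le_ni; rewrite /hgt big1 // => k; have := ltn_ord k; lia. Qed.

Lemma hgt_null (i : 'I_n) : hgt null_state i = (n.-1 - i).*2.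
Proof.
move def_d: (n.-1 - i) => d; elim: d i def_d => [|d IHd] i def_d;
  rewrite hgt_rec !ffunE; have lt_in := ltn_ord i.
  by rewrite hgt_out ?ifF; lia.
have lt_i1n : i.+1 < n by lia.
by rewrite lt_i1n (IHd (Ordinal lt_i1n)) /=; lia.
Qed.

Lemma hgt_ge c (i k : 'I_n) : i <= k -> (n.-1 - i).*2 + c k <= hgt c i.
Proof.
move def_d: (n.-1 - i) => d.
elim: d i k def_d => [|d IHd] i k def_d le_ik;
  rewrite hgt_rec; have lt_in := ltn_ord i; have lt_kn := ltn_ord k.
  by have -> : k = i by [apply: val_inj => /=; lia]; rewrite hgt_out ?ifF; lia.
have lt_i1n : i.+1 < n by lia.
have ge_next k' := IHd (Ordinal lt_i1n) k' ltac:(simpl; lia).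
rewrite lt_i1n; have [eq_ik | ne_ik] := eqVneq i k.
  by rewrite -eq_ik; have := ge_next (Ordinal lt_i1n) (leqnn _); rewrite /=; lia.
have lt_ik : i < k by rewrite ltn_neqAle ne_ik.
by have := ge_next k lt_ik; rewrite /=; lia.
Qed.

Lemma hgt_step c b (i : 'I_n) : allowed c b ->
  hgt (next_state c b) i + ~~ b i = hgt c i + b i.
Proof.
move=> /forallP ok_b; rewrite -sgn_ord.
move def_d: (n.-1 - i) => d; elim: d i def_d => [|d IHd] i def_d;
  rewrite !hgt_rec ffunE; have lt_in := ltn_ord i; have := ok_b i.
  rewrite !hgt_out; [|lia|lia].
  have -> : (i.+1 < n) = false by lia.
  rewrite /eps1 /phi1; have -> : (i.+1 < n) = false by lia.
  by case: (sgn b i) => /=; lia.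
have lt_i1n : i.+1 < n by lia.
have /= := IHd (Ordinal lt_i1n) ltac:(simpl; lia).
rewrite /eps1 /phi1 lt_i1n.
by case: (sgn b i); case: (sgn b i.+1) => /=; lia.
Qed.

Lemma sig_fst_ge (i : 'I_n) e p s : e <= (foldl (sig_step i) (e, p) s).1.
Proof.
elim: s e p => //= b s IHs e p; apply: leq_trans (IHs _ _); exact: leq_addr.
Qed.

(** Allowed letters leave no uncancelled -, and the count of + follows the state; a forbidden letter
    leaves a - that nothing later can cancel. *)
Lemma good_sig c s :
  good c s = [forall i, foldl (sig_step i) (0, c i) s == (0, 0)].
Proof.
elim: s c => [|b s IHs] c /=.
  apply/eqP/forallP => [-> i | c0]; first by rewrite ffunE.
  by apply/ffunP => i; rewrite ffunE; case/eqP: (c0 i).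
have [/forallP ok_b | /forallPn[i]] /= := boolP (allowed c b).
  rewrite IHs; apply: eq_forallb => i; rewrite ffunE /sig_step /=.
  by move/minn_idPr: (ok_b i) => ->; rewrite subnn.
rewrite -ltnNge => lt_ci; apply/esym/forallP => /(_ i) /eqP eq0.
have := sig_fst_ge i (sig_step i (0, c i) b).1 (sig_step i (0, c i) b).2 s.
by rewrite -surjective_pairing eq0 /sig_step /=; lia.
Qed.

Lemma good_wt2 c s (i : 'I_n) : good c s ->
  ((hgt c i)%:Z + wt2 s i = (hgt null_state i)%:Z)%R.
Proof.
rewrite /wt2; elim: s c => [|b s IHs] c /=.
  by move/eqP->; rewrite big_nil addr0.
case/andP=> ok_b /IHs; rewrite big_cons => <-.
by have := hgt_step c b i ok_b; case: (b i) => /=; lia.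
Qed.

Lemma trivial_comp_good s : trivial_comp s = good null_state s.
Proof.
rewrite /trivial_comp /eps_tens /phi_tens.
apply/andP/idP => [[/forallP triv _] | s_good].
  rewrite good_sig; apply/forallP => i; rewrite ffunE.
  by have := triv i; case: foldl.
split; apply/forallP => i.
  by move: s_good; rewrite good_sig => /forallP/(_ i); rewrite ffunE; case: foldl.
by have := good_wt2 null_state s i s_good; lia.
Qed.

End Walks.

(** * Determinants of ballot numbers *)

Lemma sum_tupleS (T : finType) r (F : seq T -> nat) :
  (\sum_(t : r.+1.-tuple T) F t = \sum_(x : T) \sum_(t : r.-tuple T) F (x :: t))%N.
Proof.
rewrite pair_bigA /= (reindex (fun p : T * r.-tuple T => [tuple of p.1 :: p.2])) //=.
exists (fun t => (thead t, [tuple of behead t])) => [[x t] _ | t _] /=.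
  by rewrite theadE; congr (_, _); apply: val_inj.
by case/tupleP: t => x t; apply: val_inj; rewrite /= theadE.
Qed.

(** Multilinearity in all rows at once: [b] records the summand taken in each row. *)
Lemma det_rows_add (R : comPzRingType) n (A : bool -> 'M[R]_n) :
  \det (\matrix_(i, j) (A true i j + A false i j)) =
  \sum_(b : {ffun 'I_n -> bool}) \det (\matrix_(i, j) A (b i) i j).
Proof.
rewrite /determinant exchange_big /=; apply: eq_bigr => s _.
rewrite -big_distrr /=; congr (_ * _).
transitivity (\prod_i \sum_(e : bool) A e i (s i)).
  by apply: eq_bigr => i _; rewrite mxE big_bool.
by rewrite bigA_distr_bigA; apply: eq_bigr => b _; apply: eq_bigr => i _; rewrite mxE.
Qed.

Definition ballot_mx {n} r (x : 'I_n -> nat) : 'M[int]_n :=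
  \matrix_(i, j) (ballot (r + (n.-1 - j).*2) (x i))%:Z.

Lemma det_ballot_rec n r (x : 'I_n -> nat) :
  \det (ballot_mx r.+1 (fun i => (x i).+1)) =
  \sum_(b : spin n) \det (ballot_mx r (fun i => if b i then (x i).+2 else x i)).
Proof.
pose A e := ballot_mx r (fun i => if e then (x i).+2 else x i).
transitivity (\det (\matrix_(i, j) (A true i j + A false i j))).
  by congr (\det _); apply/matrixP => i j; rewrite !mxE -PoszD.
rewrite det_rows_add; apply: eq_bigr => b _.
by congr (\det _); apply/matrixP => i j; rewrite !mxE.
Qed.

Lemma det_ballot_out n r (c : {ffun 'I_n -> nat}) (b : spin n) :
  ~~ allowed c b ->
  \det (ballot_mx r (fun i : 'I_n => if b i then (hgt c i).+2 else hgt c i)) = 0.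
Proof.
case/forallPn=> i; rewrite -ltnNge /eps1.
have [lt_i1n | ge_i1n] := ltnP i.+1 n.
  set k := Ordinal lt_i1n; rewrite -[i.+1]/(val k) !sgn_ord => lt_ci.
  (* Here [hgt c i = hgt c k + 2], so the steps down at [i] and up at [k] meet: rows [i] and [k]
     agree. *)
  have [bi bk ci] : [/\ b i = false, b k = true & c i = 0%N].
    by move: lt_ci; case: (b i); case: (b k); case: (c i).
  apply: (@determinant_alternate _ _ _ i k).
    by apply/eqP => /(congr1 val) /=; lia.
  by move=> j; rewrite !mxE bi bk hgt_rec lt_i1n ci.
rewrite sgn_ord => lt_ci.
have [bi ci] : b i = false /\ c i = 0%N by move: lt_ci; case: (b i); case: (c i).
rewrite (expand_det_row _ i) big1 // => j _; rewrite mxE bi hgt_rec ltnNge ge_i1n ci.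
by rewrite hgt_out // ballotx0 mul0r.
Qed.

Lemma det_ballot0 n (c : {ffun 'I_n -> nat}) :
  \det (ballot_mx 0 (fun i : 'I_n => (hgt c i).+1)) = (c == null_state)%:Z.
Proof.
have [-> | c_neq0] := eqVneq.
  rewrite det_trig; last first.
    apply/is_trig_mxP => i j lt_ij; rewrite mxE hgt_null ballot_gt //.
    by have := ltn_ord j; lia.
  by rewrite big1 // => i _; rewrite mxE hgt_null ballot_diag.
have [k ck] : exists k, c k != 0%N.
  apply/existsP; apply: contraNT c_neq0 => /existsPn c0.
  by apply/eqP/ffunP => k; rewrite ffunE; have /negPn/eqP := c0 k.
have lt0n : (0 < n)%N by have := ltn_ord k; lia.
(* The first row starts at height at least 2n, too high for walks of length at most 2n - 2 to reach
   1. *)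
rewrite (expand_det_row _ (Ordinal lt0n)) big1 // => j _.
rewrite mxE ballot_gt ?mul0r //.
by have := hgt_ge c (Ordinal lt0n) k (leq0n k); rewrite /=; lia.
Qed.

Lemma det_ballot_null n r :
  \det (ballot_mx r (fun i : 'I_n => (hgt (@null_state n) i).+1)) =
  \det (\matrix_(i < n, j < n)
          (ballot (r + (n.-1 - i).*2 + (n.-1 - j).*2) 1)%:Z).
Proof.
pose B s := ballot_mx s (fun i : 'I_n => (hgt (@null_state n) i).+1).
(* The unitriangular factor [B 0], transposed, turns the entries into convolutions over heights. *)
rewrite -[LHS]mul1r -[1](_ : \det (B 0) = 1); last by rewrite det_ballot0 eqxx.
rewrite -det_tr -det_mulmx; congr (\det _); apply/matrixP => i j; rewrite !mxE.
have -> : (r + (n.-1 - i).*2 + (n.-1 - j).*2 =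
           r + (n.-1 - j).*2 + (n.-1 - i).*2)%N by lia.
rewrite -(@ballot_convolution _ _ n.*2); last by have := ltn_ord i; lia.
(* Even heights contribute nothing by parity; the odd ones are the coordinates of 2 rho in reverse
   order. *)
rewrite (sum_nat_double (fun x => ballot _ x * ballot _ x)%N).
rewrite [in RHS](reindex_inj rev_ord_inj) /= (raddf_sum Posz) /=; apply: eq_bigr => k _.
rewrite !mxE hgt_null mulrC -PoszM; congr Posz.
rewrite (@ballot_parity (n.-1 - i).*2 (n - k.+1).*2) ?odd_double // muln0 add0n.
by have -> : (n - k.+1 = n.-1 - k)%N by lia.
Qed.

Lemma card_good n r (c : {ffun 'I_n -> nat}) :
  (#|[set t : r.-tuple (spin n) | good c t]|)%:Z =
  \det (ballot_mx r (fun i : 'I_n => (hgt c i).+1)).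
Proof.
have cardE r' c' : #|[set t : r'.-tuple (spin n) | good c' t]| =
    (\sum_(t : r'.-tuple (spin n)) good c' t)%N.
  by rewrite cardsE -sum1_card big_mkcond.
elim: r c => [|r IHr] c.
  rewrite det_ballot0 cardE (big_pred1 [tuple]) // => t.
  by rewrite [t]tuple0 /= eqxx.
rewrite det_ballot_rec cardE (sum_tupleS _ _ (fun s => good c s : nat)) (raddf_sum Posz) /=.
apply: eq_bigr => b _; have [ok_b | not_ok] := boolP (allowed c b); last first.
  by rewrite det_ballot_out // big1.
rewrite -cardE IHr; congr (\det _); apply/matrixP => i j; rewrite !mxE.
congr (Posz (ballot _ _)); have := hgt_step c b i ok_b.
by case: (b i) => /=; lia.
Qed.

Theorem theorem4p1 (n m : nat) (hn : (1 <= n)%N) (hm : (1 <= m)%N) :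
  ((mult_trivial n (2 * m))%:Z : int) =
  \det (\matrix_(i < n, j < n) ((Cat (2 * n - i.+1 - j.+1 + m))%:Z : int)).
Proof.
rewrite /mult_trivial.
under eq_finset => t do rewrite trivial_comp_good.
rewrite card_good det_ballot_null; congr (\det _); apply/matrixP => i j; rewrite !mxE.
rewrite -ballot_Cat; congr (Posz (ballot _ _)).
by have := ltn_ord i; have := ltn_ord j; lia.
Qed.
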